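(* Let $G=(V,E)$ be a finite connected graph with vertices $v_1,\dots,v_n$, $n=|V|$, and distance matrix $D=(d(v_i,v_j))_{i,j=1}^n$. Suppose $w\in\mathbb{R}^n$ satisfies $Dw=n\cdot\mathbf{1}$ and $K=\min_i w_i\ge 0$. Then $$\operatorname{diam}(G)\le \frac{2n}{\|w\|_{\ell^1}}\le \frac{2}{K}.$$ Moreover, if $\operatorname{diam}(G)\cdot K=2$, then $G$ has constant curvature (i.e. there is a constant $c\in\mathbb{R}$ with $D(c\,\mathbf{1})=n\cdot\mathbf{1}$).
   Context: Graphs are finite, simple, undirected and unweighted; $d(u,v)$ is the shortest-path (combinatorial) distance, $\operatorname{diam}(G)=\max_{u,v}d(u,v)$, $\mathbf{1}\in\mathbb{R}^n$ is the all-ones vector, and $\|w\|_{\ell^1}=\sum_i|w_i|$. A vector $w$ with $Dw=n\cdot\mathbf{1}$ is called a curvature of $G$, $w_i$ being the curvature at $v_i$. $G$ has constant curvature $c$ if the constant vector $w=c\,\mathbf{1}$ satisfies $Dw=n\cdot\mathbf{1}$. When $K=0$, $2/K$ is interpreted as $+\infty$. *)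

(* Defs.v *)
From mathcomp Require Import all_boot all_order all_algebra.
From mathcomp Require Import reals constructive_ereal.

Set Implicit Arguments.
Unset Strict Implicit.
Unset Printing Implicit Defensive.

Import Order.TTheory GRing.Theory Num.Theory.
Local Open Scope ring_scope.

(* A finite simple graph is a finType V with a symmetric irreflexive relation e. *)

Definition connected_graph (V : finType) (e : rel V) : Prop :=
  forall x y : V, connect e x y.

Definition has_walk (V : finType) (e : rel V) (x y : V) (k : nat) : bool :=
  [exists p : k.-tuple V, path e x p && (last x p == y)].

(* The least length of a walk from x to y.  Only lengths below #|V| are searched,
   which is enough when y is reachable from x (see gdistP); otherwise the value
   is #|V|. *)
Definition gdist (V : finType) (e : rel V) (x y : V) : nat :=
  find (has_walk e x y) (iota 0 #|V|).

Definition gdiam (V : finType) (e : rel V) : nat :=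
  \max_(x : V) \max_(y : V) gdist e x y.

(* v enumerates the n vertices; as n = #|V| is intended, statements require
   v to be bijective. *)
Definition distance_matrix (R : realType) (V : finType) (e : rel V) (n : nat)
    (v : 'I_n -> V) : 'M[R]_n :=
  \matrix_(i, j) (gdist e (v i) (v j))%:R.

Definition is_curvature (R : realType) (V : finType) (e : rel V) (n : nat)
    (v : 'I_n -> V) (w : 'cV[R]_n) : Prop :=
  distance_matrix R e v *m w = const_mx n%:R.

Definition has_constant_curvature (R : realType) (V : finType) (e : rel V)
    (n : nat) (v : 'I_n -> V) (c : R) : Prop :=
  is_curvature e v (const_mx c).

Definition l1norm (R : realType) (n : nat) (w : 'cV[R]_n) : R :=
  \sum_(i < n) `|w i 0|.

Definition is_min_entry (R : realType) (n : nat) (w : 'cV[R]_n) (K : R) : Prop :=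
  (exists i, w i 0 = K) /\ (forall i, K <= w i 0).

Lemma has_walkP (V : finType) (e : rel V) (x y : V) (k : nat) :
  reflect (exists p : seq V, [/\ path e x p, last x p = y & size p = k])
          (has_walk e x y k).
Proof.
apply: (iffP existsP) => [[p /andP[pe /eqP pl]]|[p [pe pl /eqP sp]]].
  by exists p; rewrite size_tuple.
by exists (Tuple sp) => /=; rewrite pe pl eqxx.
Qed.

Lemma gdistP (V : finType) (e : rel V) (x y : V) : connect e x y ->
  (exists p : seq V, [/\ path e x p, last x p = y & size p = gdist e x y]) /\
  (forall p : seq V, path e x p -> last x p = y -> (gdist e x y <= size p)%N).
Proof.
case/connectP=> q qe ql.
have [p' [p'e up' p'l]] :
    exists p', [/\ path e x p', uniq (x :: p') & last x p' = y].
  by rewrite ql; case: (shortenP qe) => p' ? ? _; exists p'.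
have sp' : (size p' < #|V|)%N by have := max_card (mem (x :: p')); rewrite (card_uniqP up').
have hs : has (has_walk e x y) (iota 0 #|V|).
  apply/hasP; exists (size p'); first by rewrite mem_iota.
  by apply/has_walkP; exists p'.
split.
  apply/has_walkP; have := nth_find 0%N hs.
  by rewrite nth_iota // -[X in (_ < X)%N](size_iota 0) -has_find.
move=> p pe pl; rewrite leqNgt; apply/negP => lt_p.
have := before_find 0%N lt_p; rewrite nth_iota ?add0n.
  suff -> : has_walk e x y (size p) by [].
  by apply/has_walkP; exists p.
by apply: leq_trans lt_p _; rewrite -[X in (_ <= X)%N](size_iota 0) find_size.
Qed.

(* Main.v *)
Require Import Defs.
From mathcomp Require Import all_boot all_order all_algebra.
From mathcomp Require Import reals constructive_ereal.

Set Implicit Arguments.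
Unset Strict Implicit.
Unset Printing Implicit Defensive.

Import Order.TTheory GRing.Theory Num.Theory.
Local Open Scope ring_scope.

(** Add the equations of the system [D w = n 1] at two vertices [x] and [y]:
    [\sum_j (d(x, v_j) + d(y, v_j)) w_j = 2 n].  By the triangle inequality each
    weight is at least [d(x, y)], and [w] is nonnegative, so
    [d(x, y) * l1norm w <= 2 n] ([gdist_l1norm_le]).  Maximizing over [x] and [y]
    gives the diameter bound once [l1norm w > 0], which holds because [w = 0]
    would solve the system only for [n = 0].  The second bound is
    [n K <= l1norm w], every entry being at least [K].  If [diam * K = 2], both
    bounds are equalities, so [l1norm w = n K]: a sum of [n] numbers that are
    all at least [K] equals [n K] only if each of them is [K], so [w] is itself
    a constant curvature. *)

(** Reversing a shortest walk from [y] to [x] gives a walk of the same length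
    from [x] to [y]. *)
Lemma gdist_sym_le (V : finType) (e : rel V) (x y : V) :
  symmetric e -> connected_graph e -> (gdist e x y <= gdist e y x)%N.
Proof.
move=> e_sym e_conn.
have [[p [pe pl <-]] _] := gdistP (e_conn y x).
have [_ dist_le] := gdistP (e_conn x y).
rewrite -(size_belast y p) -size_rev; apply: dist_le.
- rewrite -pl rev_path (@eq_path _ _ e) // => a b; exact: e_sym.
- by case: p pe pl => [_ <-|a p _ _] //=; rewrite rev_cons last_rcons.
Qed.

Lemma gdist_sym (V : finType) (e : rel V) (x y : V) :
  symmetric e -> connected_graph e -> gdist e x y = gdist e y x.
Proof. by move=> ? ?; apply/eqP; rewrite eqn_leq !gdist_sym_le. Qed.

Lemma gdist_triangle (V : finType) (e : rel V) (x y z : V) :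
  connected_graph e -> (gdist e x z <= gdist e x y + gdist e y z)%N.
Proof.
move=> e_conn.
have [[p [pe pl <-]] _] := gdistP (e_conn x y).
have [[q [qe ql <-]] _] := gdistP (e_conn y z).
have [_ dist_le] := gdistP (e_conn x z).
by rewrite -size_cat; apply: dist_le; rewrite ?cat_path ?last_cat pl ?pe.
Qed.

Lemma is_curvatureE (R : realType) (V : finType) (e : rel V) (n : nat)
    (v : 'I_n -> V) (w : 'cV[R]_n) (i : 'I_n) :
  is_curvature e v w -> \sum_j (gdist e (v i) (v j))%:R * w j 0 = n%:R.
Proof.
move=> /matrixP/(_ i 0); rewrite !mxE => <-.
by apply: eq_bigr => j _; rewrite mxE.
Qed.

Lemma l1norm_nneg (R : realType) (n : nat) (w : 'cV[R]_n) :
  (forall i, 0 <= w i 0) -> l1norm w = \sum_i w i 0.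
Proof. by move=> w_ge0; apply: eq_bigr => i _; rewrite ger0_norm. Qed.

Lemma l1norm_curvature_gt0 (R : realType) (V : finType) (e : rel V) (n : nat)
    (v : 'I_n -> V) (w : 'cV[R]_n) :
  (0 < n)%N -> is_curvature e v w -> 0 < l1norm w.
Proof.
case: n v w => // n v w _ w_curv.
rewrite lt_def sumr_ge0 ?andbT => [|i _]; last exact: normr_ge0.
apply/eqP => /psumr_eq0P w0.
have /eqP := is_curvatureE ord0 w_curv; rewrite big1 => [|j _].
  by rewrite eq_sym pnatr_eq0.
have /eqP : `|w j 0| = 0 by apply: w0 => // i _; exact: normr_ge0.
by rewrite normr_eq0 => /eqP ->; rewrite mulr0.
Qed.

(** Adding rows [i] and [k] of the system is what brings in the triangle
    inequality through [v_j]; symmetry turns the weight [d(v_k, v_j)] of row [k]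
    into the second leg [d(v_j, v_k)]. *)
Lemma gdist_l1norm_le (R : realType) (V : finType) (e : rel V) (n : nat)
    (v : 'I_n -> V) (w : 'cV[R]_n) (i k : 'I_n) :
    symmetric e -> connected_graph e -> is_curvature e v w ->
    (forall j, 0 <= w j 0) ->
  (gdist e (v i) (v k))%:R * l1norm w <= 2 * n%:R.
Proof.
move=> e_sym e_conn w_curv w_ge0.
rewrite (mulr_natl _ 2) mulr2n -{1}(is_curvatureE i w_curv) -(is_curvatureE k w_curv).
rewrite -big_split l1norm_nneg // mulr_sumr; apply: ler_sum => j _ /=.
rewrite -mulrDl ler_wpM2r // -natrD ler_nat (gdist_sym (v k) (v j) e_sym) //.
exact: gdist_triangle.
Qed.

Lemma gdiam_l1norm_le (R : realType) (V : finType) (e : rel V) (n : nat)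
    (v : 'I_n -> V) (w : 'cV[R]_n) :
    symmetric e -> connected_graph e -> bijective v -> is_curvature e v w ->
    (forall j, 0 <= w j 0) ->
  (gdiam e)%:R * l1norm w <= 2 * n%:R.
Proof.
move=> e_sym e_conn [v' _ v'K] w_curv w_ge0.
(* The bound is proved on each distance and carried through both maxima, so no
   pair of vertices realizing the diameter has to be chosen. *)
have max_le a b : a%:R * l1norm w <= 2 * n%:R -> b%:R * l1norm w <= 2 * n%:R ->
    (maxn a b)%:R * l1norm w <= 2 * n%:R.
  by rewrite /maxn; case: ifP.
have le0 : 0%:R * l1norm w <= 2 * n%:R by rewrite mul0r mulr_ge0.
apply: (big_ind (fun m => m%:R * l1norm w <= _)) => // x _.
apply: (big_ind (fun m => m%:R * l1norm w <= _)) => // y _.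
by rewrite -(v'K x) -(v'K y); exact: gdist_l1norm_le.
Qed.

Lemma l1norm_ge_min (R : realType) (n : nat) (w : 'cV[R]_n) (K : R) :
  (forall i, K <= w i 0) -> n%:R * K <= l1norm w.
Proof.
move=> K_le; rewrite mulr_natl -[X in _ *+ X]card_ord -sumr_const.
by apply: ler_sum => i _; rewrite (le_trans (K_le i)) ?ler_norm.
Qed.

(** The excesses [w_i - K] are nonnegative and add up to zero, so each vanishes. *)
Lemma l1norm_eq_min_const (R : realType) (n : nat) (w : 'cV[R]_n) (K : R) :
  0 <= K -> (forall i, K <= w i 0) -> l1norm w = n%:R * K -> w = const_mx K.
Proof.
move=> K_ge0 K_le; rewrite l1norm_nneg => [w_sum|i]; last exact: le_trans (K_le i).
have /psumr_eq0P excess0 : \sum_i (w i 0 - K) = 0.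
  by rewrite sumrB w_sum sumr_const card_ord mulr_natl subrr.
apply/colP => i; rewrite mxE; apply/eqP; rewrite -subr_eq0; apply/eqP.
by apply: excess0 => // j _; rewrite subr_ge0.
Qed.

Theorem theorem1 (R : realType) (V : finType) (e : rel V)
    (e_sym : symmetric e) (e_irr : irreflexive e)
    (e_conn : connected_graph e)
    (n : nat) (v : 'I_n -> V) (v_bij : bijective v)
    (w : 'cV[R]_n) (w_curv : is_curvature e v w)
    (K : R) (K_min : is_min_entry w K) (K_ge0 : 0 <= K) :
  [/\ (gdiam e)%:R <= 2 * n%:R / l1norm w,
      ((2 * n%:R / l1norm w)%:E <= (2 : R)%:E / K%:E)%E
    & (gdiam e)%:R * K = 2 ->
      exists c : R, has_constant_curvature e v c].
Proof.
case: K_min => [[i0 _] K_le].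
have n_gt0 : (0 < n)%N by exact: leq_ltn_trans (ltn_ord i0).
have w_ge0 i : 0 <= w i 0 by exact: le_trans (K_le i).
have S_gt0 := l1norm_curvature_gt0 n_gt0 w_curv.
have diam_le := gdiam_l1norm_le e_sym e_conn v_bij w_curv w_ge0.
have S_ge := l1norm_ge_min K_le.
split; first by rewrite ler_pdivlMr.
- (* Over the extended reals [2 / 0] is [+oo]. *)
  have [->|K_neq0] := eqVneq K 0.
    by rewrite inve0 gt0_muley ?leey // lte_fin.
  have K_gt0 : 0 < K by rewrite lt_def K_neq0.
  rewrite inver (negPf K_neq0) -EFinM lee_fin ler_pdivrMr // mulrAC.
  by rewrite ler_pdivlMr // -mulrA ler_pM2l.
- move=> diamK; exists K.
  have K_gt0 : 0 < K.
    rewrite lt_def K_ge0 andbT; apply/eqP => K0.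
    by move/eqP: diamK; rewrite K0 mulr0 eq_sym pnatr_eq0.
  have diam_gt0 : 0 < (gdiam e)%:R :> R by rewrite -(pmulr_lgt0 _ K_gt0) diamK.
  (* [diam * l1norm w <= 2 n = diam * (n K)]: cancel the diameter. *)
  rewrite /has_constant_curvature -(@l1norm_eq_min_const _ _ w) //.
  apply/eqP; rewrite eq_le S_ge andbT -(ler_pM2l diam_gt0).
  by rewrite mulrCA diamK [_ * 2]mulrC.
Qed.
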